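(* Let $\phi:\mathbb{R}^n\to\mathbb{R}$ be a reference function with $\operatorname{dom}\phi=\mathbb{R}^n$ such that $$\phi(\nabla\phi^*(y)-\nabla\phi^*(\bar y))\le\tfrac12\|y-\bar y\|^2\qquad\text{for all }y,\bar y\in\mathbb{R}^n .$$ Let $f\in\mathcal{C}^1(\mathbb{R}^n)$ be anisotropically smooth relative to $\phi$ with constant $L>0$ and satisfy $f_\star=\inf f>-\infty$. Let $K>0$ be an integer and let $g$ be a stochastic first-order oracle such that $\mathbb{E}[\|\nabla f(x)-g(x)\|^2]\le\frac{\sigma^2}{K}$ for all $x\in\mathbb{R}^n$. Let $x^0\in\mathbb{R}^n$ and run $x^{k+1}=x^k-\gamma\nabla\phi^*(g(x^k))$ for $K$ iterations with $0<\gamma\le\frac1L$. Then $$\mathbb{E}\left[\frac1K\sum_{k=0}^{K-1}\phi(\nabla\phi^*(\nabla f(x^k)))\right]\le\frac1K\left[\frac{f(x^0)-f_\star}{\gamma}+\frac{\sigma^2}{2}\right].$$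
   Context: $\|\cdot\|$ is the Euclidean norm on $\mathbb{R}^n$; $\phi^*$ is the convex conjugate of $\phi$. Reference function (with full domain): $\phi:\mathbb{R}^n\to\mathbb{R}$ is strongly convex and even with $\phi(0)=0$, and $\phi\in\mathcal{C}^2(\mathbb{R}^n)$. (Then $\phi^*\in\mathcal{C}^2(\mathbb{R}^n)$.) Episcaling: for $\lambda>0$, $(\lambda\star\phi)(x)=\lambda\phi(\lambda^{-1}x)$. Anisotropic smoothness: $f\in\mathcal{C}^1(\mathbb{R}^n)$ is anisotropically smooth relative to $\phi$ with constant $L>0$ if for all $x,\bar x\in\mathbb{R}^n$ $$f(x)\le f(\bar x)+\left(\tfrac1L\star\phi\right)(x-\bar y)-\left(\tfrac1L\star\phi\right)(\bar x-\bar y),\qquad \bar y=\bar x-\tfrac1L\nabla\phi^*(\nabla f(\bar x)).$$ Stochastic oracle: when queried at a point $x$, it returns a random vector $g(x)\in\mathbb{R}^n$ (a stochastic gradient). The call at each iteration uses fresh randomness, so that conditionally on $x^k$ the vector $g(x^k)$ is distributed as the oracle's output at the point $x^k$; the initial point $x^0$ is deterministic. *)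

(* Defs.v *)
(* R^n is 'rV[R]_n for R : realType. *)
From HB Require Import structures.
From mathcomp Require Import all_boot all_order all_algebra.
From mathcomp Require Import all_classical all_reals all_analysis.

Set Implicit Arguments.
Unset Strict Implicit.
Unset Printing Implicit Defensive.

Import Order.TTheory GRing.Theory Num.Theory.
Import numFieldNormedType.Exports.

Local Open Scope classical_set_scope.
Local Open Scope ring_scope.

Section euclidean.
Context {R : realType} {n : nat}.

Definition dotv (u v : 'rV[R]_n) : R := \sum_(i < n) u 0 i * v 0 i.

(* The library norm `|u| on 'rV[R]_n is the sup norm: it induces the same
   topology and the same differentiability notion, but a different norm. *)
Definition enorm (u : 'rV[R]_n) : R := Num.sqrt (dotv u u).

Definition grad (h : 'rV[R]_n -> R) (x : 'rV[R]_n) : 'rV[R]_n :=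
  \row_(i < n) 'D_(delta_mx 0 i) h x.

Definition C1 (h : 'rV[R]_n -> R) : Prop :=
  (forall x, differentiable h x) /\ continuous (grad h).

Definition C2 (h : 'rV[R]_n -> R) : Prop :=
  C1 h /\ forall i : 'I_n, C1 (fun x => grad h x 0 i).

Definition strongly_convex (h : 'rV[R]_n -> R) : Prop :=
  exists2 mu : R, 0 < mu & forall (x y : 'rV[R]_n) (t : R), 0 <= t <= 1 ->
    h (t *: x + (1 - t) *: y) <=
      t * h x + (1 - t) * h y - mu / 2 * t * (1 - t) * enorm (x - y) ^+ 2.

Definition conjugate (h : 'rV[R]_n -> R) (y : 'rV[R]_n) : \bar R :=
  ereal_sup (range (fun x : 'rV[R]_n => (dotv x y - h x)%:E)).

(* The conjugate of a strongly convex real-valued function is finite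
   everywhere, so that [fine] only changes its type. *)
Definition grad_conj (h : 'rV[R]_n -> R) : 'rV[R]_n -> 'rV[R]_n :=
  grad (fun y => fine (conjugate h y)).

Record reference_function (phi : 'rV[R]_n -> R) : Prop := {
  reference_strongly_convex : strongly_convex phi ;
  reference_even : forall x, phi (- x) = phi x ;
  reference0 : phi 0 = 0 ;
  reference_C2 : C2 phi }.

Definition episcaling (lambda : R) (phi : 'rV[R]_n -> R) (x : 'rV[R]_n) : R :=
  lambda * phi (lambda^-1 *: x).

Definition anisotropically_smooth (phi f : 'rV[R]_n -> R) (L : R) : Prop :=
  forall x xbar : 'rV[R]_n,
    let ybar := xbar - L^-1 *: grad_conj phi (grad f xbar) in
    f x <= f xbar + episcaling L^-1 phi (x - ybar)
                  - episcaling L^-1 phi (xbar - ybar).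

End euclidean.

(* R^n with its Borel sigma-algebra; convertible to 'rV[R]_n. *)
Notation borel_rV R n := (g_sigma_algebraType (@open 'rV[R]_n)).

(* nu is a regular conditional distribution of Y given X:
   P(X \in A, Y \in B) = E[1_{X \in A} nu(X, B)]. *)
Definition conditional_law d (Omega : measurableType d) (R : realType)
    (P : probability Omega R) d1 (T1 : measurableType d1)
    d2 (T2 : measurableType d2) (X : Omega -> T1) (Y : Omega -> T2)
    (nu : R.-pker T1 ~> T2) : Prop :=
  forall (A : set T1) (B : set T2), measurable A -> measurable B ->
    P (X @^-1` A `&` Y @^-1` B) = (\int[P]_(w in X @^-1` A) nu (X w) B)%E.

(* Main.v *)
(* With [a = grad_conj phi (grad f x)] and [b = grad_conj phi v], anisotropic
   smoothness at the point [x] and convexity of [phi] give the pathwise descent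
     f (x - gamma b) <= f x - gamma phi a + gamma phi (a - b),
   because [a - gamma L b] is the convex combination of [a - b] and [a] with
   weight [gamma L <= 1]. The hypothesis on [phi] bounds [phi (a - b)] by half of
   the squared oracle error; summing over the iterations telescopes [f], and
   taking expectations bounds each squared error by [sigma ^ 2 / K]. *)
Require Import Defs.
From HB Require Import structures.
From mathcomp Require Import all_boot all_order all_algebra.
From mathcomp Require Import all_classical all_reals all_analysis.
From mathcomp Require Import measurable_realfun.
From mathcomp Require Import ring lra.

Set Implicit Arguments.
Unset Strict Implicit.
Unset Printing Implicit Defensive.

Import Order.TTheory GRing.Theory Num.Theory.
Import numFieldNormedType.Exports.

Local Open Scope classical_set_scope.
Local Open Scope ring_scope.

(** * Euclidean norm against sup norm *)

Section euclidean_space.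
Context {R : realType} {n : nat}.
Implicit Types u v : 'rV[R]_n.

Lemma dotv_ge0 u : 0 <= dotv u u.
Proof. by apply: sumr_ge0 => i _; rewrite -expr2 sqr_ge0. Qed.

Lemma enorm_sq u : enorm u ^+ 2 = \sum_(i < n) u 0 i ^+ 2.
Proof. by rewrite sqr_sqrtr ?dotv_ge0. Qed.

Lemma enormZ_sq a u : enorm (a *: u) ^+ 2 = a ^+ 2 * enorm u ^+ 2.
Proof.
by rewrite !enorm_sq mulr_sumr; apply: eq_bigr => i _; rewrite mxE exprMn.
Qed.

Lemma coord_sq_le u i : u 0 i ^+ 2 <= enorm u ^+ 2.
Proof.
by rewrite enorm_sq (bigD1 i)//= lerDl sumr_ge0// => j _; exact: sqr_ge0.
Qed.

Lemma norm_le_enorm u : `|u| <= enorm u.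
Proof.
rewrite /Num.Def.normr/= mx_normrE; apply/bigmax_leP; split=> [|[j i] _] /=.
  exact: sqrtr_ge0.
by rewrite (ord1 j) -ler_sqr ?nnegrE ?sqrtr_ge0// real_normK ?num_real ?coord_sq_le.
Qed.

Lemma enorm_sq_le u : enorm u ^+ 2 <= n%:R * `|u| ^+ 2.
Proof.
rewrite enorm_sq -[n in n%:R]card_ord -sumr_const mulr_suml.
apply: ler_sum => i _; rewrite mul1r -real_normK ?num_real// ler_sqr ?nnegrE//.
by rewrite [leRHS]mx_normrE; exact: (le_bigmax _ _ (0, i)).
Qed.

Lemma mx_ballE u e : 0 < e -> ball u e = [set v | forall i, `|u 0 i - v 0 i| < e].
Proof.
move=> e0; apply/seteqP; split=> v /=; first by move=> [_ h] i; exact: h.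
by move=> h; split=> // j i; rewrite (ord1 j); exact: h.
Qed.

End euclidean_space.

(** * Borel measurability of vector-valued maps *)

Section borel_rV_measurability.
Context {R : realType} {n : nat}.

Lemma continuous_borel_measurable m (F : 'rV[R]_n -> 'rV[R]_m) : continuous F ->
  measurable_fun [set: borel_rV R n] (F : borel_rV R n -> borel_rV R m).
Proof.
move=> cF; apply: measurability; first reflexivity.
move=> _ [U oU <-]; rewrite setTI; apply: sub_sigma_algebra.
by apply: open_comp => // x _; exact: cF.
Qed.

Lemma continuous_borel_measurable_real (F : 'rV[R]_n -> R) : continuous F ->
  measurable_fun [set: borel_rV R n] (F : borel_rV R n -> R).
Proof.
move=> cF; apply: (measurability _ (RGenOInfty.measurableE R)).
move=> _ [_ [a ->] <-]; rewrite setTI; apply: sub_sigma_algebra.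
by apply: open_comp => [x _|]; [exact: cF|exact: rray_open].
Qed.

Lemma measurable_coord i :
  measurable_fun [set: borel_rV R n] (fun u : borel_rV R n => (u : 'rV[R]_n) 0 i).
Proof. exact: continuous_borel_measurable_real (@coord_continuous R 1 n 0 i). Qed.

(* An open set is the union of the rational sup-norm balls it contains, and such
   a ball is a finite intersection of coordinate slabs. *)
Lemma measurable_fun_rV d (T : measurableType d) (X : T -> 'rV[R]_n) :
  (forall i, measurable_fun setT (fun w => X w 0 i)) ->
  measurable_fun setT (X : T -> borel_rV R n).
Proof.
move=> mX; apply: measurability; first reflexivity.
move=> _ [U oU <-]; rewrite setTI.
pose c (q : 'rV[rat]_n) : 'rV[R]_n := map_mx ratr q.
pose B (p : 'rV[rat]_n * nat) : set T :=
  [set w | ball (c p.1) p.2.+1%:R^-1 `<=` U /\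
           forall i, `|c p.1 0 i - X w 0 i| < p.2.+1%:R^-1].
rewrite (_ : X @^-1` U = \bigcup_p B p); last first.
  apply/seteqP; split=> [w /= Uw|w [p _ [pU pw]]]; last first.
    by apply: pU; rewrite mx_ballE.
  have /nbhs_ballP[e /= e0 eU] : nbhs (X w) U by exact: open_nbhs_nbhs.
  (* The radius also bounds the distance from the rational centre to [X w]; below [e / 2], it keeps
     the ball inside the [e]-ball around [X w]. *)
  have [k ke] : exists k, k.+1%:R^-1 < e / 2.
    have e20 : 0 < e / 2 by rewrite divr_gt0.
    have [k _ hk] := near_infty_natSinv_lt (PosNum e20).
    by exists k; exact: (hk k (leqnn k)).
  have k0 : 0 < k.+1%:R^-1 :> R by rewrite invr_gt0.
  have /(_ _)/cid h (i : 'I_n) : exists q : rat, `|ratr q - X w 0 i| < k.+1%:R^-1.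
    have : X w 0 i - k.+1%:R^-1 < X w 0 i + k.+1%:R^-1.
      by rewrite ltrBlDr -addrA ltrDl addr_gt0.
    by move=> /rat_in_itvoo[q /[!in_itv]/= hq]; exists q; rewrite ltr_distl.
  exists (\row_i sval (h i), k) => //; split=> /=; last first.
    by move=> i; rewrite !mxE; exact: (svalP (h i)).
  apply: subset_trans eU; rewrite !mx_ballE// => v /= vq i.
  have := vq i; have := svalP (h i); rewrite !mxE => h1 h2.
  rewrite (le_lt_trans (ler_distD (ratr (sval (h i))) _ _))//.
  by rewrite distrC (splitr e) ltrD// (lt_trans _ ke).
apply: countable_bigcupT_measurable => [|p]; first exact: countableP.
(* The inclusion in [U] does not depend on [w], so [B p] is either empty or a finite intersection of
   slabs. *)
have [pU|pU] := pselect (ball (c p.1) p.2.+1%:R^-1 `<=` U); last first.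
  by rewrite (_ : B p = set0)// -subset0 => w [].
rewrite (_ : B p = \bigcap_i [set w | `|c p.1 0 i - X w 0 i| < p.2.+1%:R^-1]).
  apply: fin_bigcap_measurable => // i _; rewrite -[X in measurable X]setTI.
  apply: measurable_fun_ltr => //; apply: measurableT_comp => //.
  exact: measurable_funB.
by apply/seteqP; split=> w /= => [[_ h] i _|h]; [exact: h|split=> // i; exact: h].
Qed.

End borel_rV_measurability.

(** * Joint law of a query point and its oracle output *)

Section graph_kernel.
Context d d1 d2 (S : measurableType d) (T1 : measurableType d1)
  (T2 : measurableType d2) (R : realType).
Variables (X : S -> T1) (nu : R.-pker T1 ~> T2).
Hypothesis mX : measurable_fun setT X.

(** The law of [(X s, v)] for [v] drawn from [nu (X s)], that is, the Dirac mass at [X s] times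
    [nu (X s)]. *)
Definition graph_kernel of measurable_fun setT X :
  S -> {measure set (T1 * T2) -> \bar R}.
Proof.
move=> s; refine (pushforward (nu (X s)) (pair (X s))).
exact: pair1_measurable.
Defined.

Lemma graph_kernelE s A : graph_kernel mX s A = nu (X s) (xsection A (X s)).
Proof. by rewrite /graph_kernel/= /pushforward xsectionE. Qed.

Let measurable_graph_kernel U : measurable U ->
  measurable_fun [set: S] (graph_kernel mX ^~ U).
Proof.
move=> mU; rewrite (_ : graph_kernel mX ^~ U =
  (fun z => nu z (xsection U z)) \o X); last first.
  by apply/funext => s; rewrite graph_kernelE.
apply: measurableT_comp => //.
by apply: measurable_fun_xsection_finite_kernel; rewrite inE.
Qed.

HB.instance Definition _ := isKernel.Build _ _ _ _ _ (graph_kernel mX)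
  measurable_graph_kernel.

Let graph_kernel_setT s : graph_kernel mX s setT = 1%E.
Proof. by rewrite /graph_kernel/= /pushforward preimage_setT prob_kernel. Qed.

HB.instance Definition _ := Kernel_isProbability.Build _ _ _ _ _
  (graph_kernel mX) graph_kernel_setT.

End graph_kernel.
Arguments graph_kernel {d d1 d2 S T1 T2 R X} nu.

Section conditional_expectation.
Local Open Scope ereal_scope.
Context d (Omega : measurableType d) (R : realType) (P : probability Omega R).
Context d1 (T1 : measurableType d1) d2 (T2 : measurableType d2).
Variables (X : Omega -> T1) (Y : Omega -> T2) (nu : R.-pker T1 ~> T2).
Hypotheses (mX : measurable_fun setT X) (mY : measurable_fun setT Y).
Hypothesis XY : conditional_law P X Y nu.

(** Disintegration: the joint law of [(X, Y)] is [P] composed with [graph_kernel], and integration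
    against a composed kernel is an iterated integral. *)
Lemma conditional_law_integral (h : T1 * T2 -> \bar R) :
  (forall z, 0 <= h z) -> measurable_fun setT h ->
  \int[P]_w h (X w, Y w) = \int[P]_w \int[nu (X w)]_v h (X w, v).
Proof.
move=> h0 mh.
have mXY : measurable_fun setT (fun w => (X w, Y w)) by exact: measurable_fun_pair.
have mXs : measurable_fun setT (X \o snd : unit * Omega -> T1).
  exact: measurableT_comp.
(* [P] is viewed as a kernel from the one-point space, so that the joint law becomes the kernel
   composition [mkcomp l k] at [tt]. *)
pose l := kprobability (measurable_cst (P : pprobability Omega R) :
  measurable_fun [set: unit] _).
pose k := graph_kernel nu mXs.
(* Both measures agree on rectangles, which is the definition of
   [conditional_law], hence everywhere. *)
have joint A : measurable A -> pushforward P (fun w => (X w, Y w)) A = mkcomp l k tt A.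
  apply: (measure_unique [set A `*` B | A in measurable & B in measurable]
    (fun=> setT)) => //.
  - by rewrite measurable_prod_measurableType.
  - move=> _ _ [A1 mA1 [B1 mB1 <-]] [A2 mA2 [B2 mB2 <-]].
    exists (A1 `&` A2); first exact: measurableI.
    by exists (B1 `&` B2); [exact: measurableI|rewrite setXI].
  - by move=> _; exists setT => //; exists setT => //; rewrite setXTT.
  - by rewrite bigcup_const.
  - move=> _ [A1 mA1 [B1 mB1 <-]].
    rewrite /= /pushforward /mkcomp /kcomp/=.
    transitivity (P (X @^-1` A1 `&` Y @^-1` B1)); first by [].
    rewrite XY// [LHS]integral_mkcond; apply: eq_integral => w _.
    transitivity (nu (X w) (xsection (A1 `*` B1) (X w))); last by rewrite xsectionE.
    (* The section of the rectangle at [X w] is [B1] or empty according to whether [X w] lies in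
       [A1], which reproduces the restriction of the integral. *)
    rewrite /patch; case: ifPn => [/set_mem xA|xA].
      by rewrite in_xsectionX// inE.
    by rewrite notin_xsectionX ?measure0//; move: xA; rewrite !notin_setE.
  - move=> _; rewrite /= /pushforward preimage_setT.
    by rewrite [X in X < _]probability_setT ltry.
transitivity (\int[mkcomp l k tt]_z h z).
  have := ge0_integral_pushforward mXY P (D := setT) measurableT mh (fun z _ => h0 z).
  rewrite preimage_setT => <-; apply: eq_measure_integral => A mA _; exact: joint.
rewrite integral_kcomp//; apply: eq_integral => w _.
rewrite ge0_integral_pushforward//; exact: measurable_fun_pair.
Qed.

End conditional_expectation.

(** The radius [e / (C + 1)] works because [C < (C + 1) ^+ 2], also when [C = 0]. Squares avoid
    taking roots of the bounds available. *)
Lemma lipschitz_sq_continuous (R : realType) (V W : normedModType R) (F : V -> W)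
    (C : R) : 0 <= C ->
  (forall y z, `|F y - F z| ^+ 2 <= C * `|y - z| ^+ 2) -> continuous F.
Proof.
move=> C0 FC y; apply/cvgrPdist_lt => e e0.
have d0 : 0 < e / (C + 1) by rewrite divr_gt0// ltr_wpDl.
near=> z.
have yz : `|y - z| < e / (C + 1) by near: z; exact: cvgr_dist_lt.
rewrite -ltr_sqr ?nnegrE ?(ltW e0)//; apply: (le_lt_trans (FC y z)).
have C1 : 0 < C + 1 by rewrite ltr_wpDl.
have sq : `|y - z| ^+ 2 <= (e / (C + 1)) ^+ 2.
  by rewrite ler_sqr ?nnegrE ?(ltW d0)// ltW.
apply: (le_lt_trans (ler_wpM2l C0 sq)).
rewrite expr_div_n mulrA ltr_pdivrMr ?exprn_gt0// mulrC ltr_pM2l ?exprn_gt0//.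
by nra.
Unshelve. all: by end_near. Qed.

(** * Reference functions and the one-step descent *)

Section reference_function_theory.
Context {R : realType} {n : nat} {phi : 'rV[R]_n -> R}.
Hypothesis phi_ref : reference_function phi.

Lemma reference_convex x y (t : R) : 0 <= t <= 1 ->
  phi (t *: x + (1 - t) *: y) <= t * phi x + (1 - t) * phi y.
Proof.
have [mu mu0 sc] := reference_strongly_convex phi_ref.
move=> t01; apply: (le_trans (sc x y t t01)); case/andP: t01 => t0 t1.
rewrite gerBl mulr_ge0 ?sqr_ge0// mulr_ge0 ?subr_ge0// mulr_ge0//.
by rewrite divr_ge0// ltW.
Qed.

(* Evenness turns strong convexity at the midpoint of [x] and [- x] into
   quadratic growth from [phi 0 = 0]. *)
Lemma reference_quadratic_growth : exists2 mu : R, 0 < mu &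
  forall x, mu * enorm x ^+ 2 <= phi x.
Proof.
have [mu mu0 sc] := reference_strongly_convex phi_ref.
(* The midpoint term is [mu / 2] times 1/4 times the squared norm of [2 *: x], hence the constant
   [mu / 2]. *)
exists (mu / 2) => [|x]; first by rewrite divr_gt0.
have h01 : 0 <= (2^-1 : R) <= 1 by lra.
have := sc x (- x) 2^-1 h01.
rewrite reference_even// opprK (_ : x + x = 2 *: x); last by rewrite scaler_nat.
rewrite enormZ_sq.
rewrite scalerN -scalerBl (_ : 2^-1 - (1 - 2^-1) = 0 :> R); last by lra.
rewrite scale0r reference0//; set N := enorm x ^+ 2; lra.
Qed.

Lemma reference_ge0 x : 0 <= phi x.
Proof.
have [mu mu0 /(_ x)] := reference_quadratic_growth.
by apply: le_trans; rewrite mulr_ge0 ?sqr_ge0 ?(ltW mu0).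
Qed.

Lemma reference_continuous : continuous phi.
Proof.
move=> x; apply: differentiable_continuous.
by have [[]] := reference_C2 phi_ref.
Qed.

Hypothesis phi_lip : forall y ybar : 'rV[R]_n,
  phi (grad_conj phi y - grad_conj phi ybar) <= 2^-1 * enorm (y - ybar) ^+ 2.

(** Quadratic growth bounds the left side of [phi_lip] from below, so [grad_conj phi] is Lipschitz.
    Measurability of the iterates rests on this. *)
Lemma grad_conj_continuous : continuous (grad_conj phi).
Proof.
have [mu mu0 growth] := reference_quadratic_growth.
(* The factors come from the growth constant, from [phi_lip], and from comparing the Euclidean norm
   with the sup norm. *)
apply: (@lipschitz_sq_continuous _ _ _ _ (mu^-1 * (2^-1 * n%:R))) => [|y z].
  by rewrite !mulr_ge0 ?invr_ge0 ?ler0n ?(ltW mu0).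
rewrite -!mulrA -ler_pdivrMl ?invr_gt0// invrK.
apply: (@le_trans _ _ (2^-1 * enorm (y - z) ^+ 2)); last first.
  by rewrite ler_pM2l ?invr_gt0// enorm_sq_le.
apply: le_trans (phi_lip y z); apply: le_trans (growth _).
rewrite ler_pM2l// ler_sqr ?nnegrE ?normr_ge0 ?sqrtr_ge0//.
exact: norm_le_enorm.
Qed.

Lemma descent_step (f : 'rV[R]_n -> R) (L gamma : R) x v : 0 < L ->
  anisotropically_smooth phi f L -> 0 < gamma -> gamma <= L^-1 ->
  f (x - gamma *: grad_conj phi v) <=
    f x - gamma * phi (grad_conj phi (grad f x))
        + gamma / 2 * enorm (grad f x - v) ^+ 2.
Proof.
move=> L0 /(_ (x - gamma *: grad_conj phi v) x) /= + g0 gL.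
set a := grad_conj phi (grad f x); set b := grad_conj phi v.
rewrite /episcaling invrK !opprB.
have L1 : L * L^-1 = 1 by rewrite divff ?gt_eqF.
have -> : L *: (x + (L^-1 *: a - x)) = a.
  by rewrite addrCA subrr addr0 scalerA L1 scale1r.
have -> : L *: (x - gamma *: b + (L^-1 *: a - x)) =
    (gamma * L) *: (a - b) + (1 - gamma * L) *: a.
  by apply/rowP => i; rewrite !mxE; field; rewrite gt_eqF.
have t01 : 0 <= gamma * L <= 1.
  by rewrite mulr_ge0 ?(ltW g0) ?(ltW L0)//= -ler_pdivlMr// mul1r.
have := reference_convex (a - b) a t01.
move: (phi_lip (grad f x) v); rewrite -/a -/b.
set p := phi (a - b); set q := phi a; set r := phi (_ + _).
set N := enorm _ ^+ 2 => pN rpq /le_trans; apply.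
(* This is the convexity bound divided by [L]; its term [L^-1 * q] cancels the episcaled value at
   the current point. *)
have : L^-1 * r <= gamma * p + L^-1 * q - gamma * q.
  rewrite -(ler_pM2l L0) mulrA L1 mul1r.
  by rewrite mulrBr mulrDr [L * (L^-1 * q)]mulrA L1 mul1r; nra.
have : gamma * p <= gamma / 2 * N by rewrite -mulrA ler_pM2l.
by lra.
Qed.

End reference_function_theory.

(** * Expected squared error of the oracle *)

Section oracle_error.
Context {R : realType} {n : nat} (F : 'rV[R]_n -> 'rV[R]_n).
Hypothesis cF : continuous F.

Definition sq_error (p : borel_rV R n * borel_rV R n) : \bar R :=
  (enorm (F p.1 - p.2) ^+ 2)%:E.

Lemma sq_error_ge0 p : (0 <= sq_error p)%E.
Proof. by rewrite lee_fin sqr_ge0. Qed.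

(** Expanding the norm in coordinates leaves only real functions on the product sigma-algebra, each
    depending on one factor. *)
Lemma measurable_sq_error : measurable_fun setT sq_error.
Proof.
apply/measurable_EFinP; rewrite (_ : (fun _ => _) =
  fun p => \sum_(i < n) (F p.1 0 i - (p.2 : 'rV_n) 0 i) ^+ 2); last first.
  by apply/funext => p; rewrite enorm_sq; apply: eq_bigr => i _; rewrite !mxE.
apply: measurable_sum => i; apply: measurable_funX; apply: measurable_funB.
  apply: (measurableT_comp (measurable_coord i)).
  exact: (measurableT_comp (continuous_borel_measurable cF)).
exact: (measurableT_comp (measurable_coord i)).
Qed.

(** Conditioning on [X] turns the expectation into an average of inner integrals, each at most
    [s]. *)
Lemma oracle_sq_error_le d (Omega : measurableType d) (P : probability Omega R)
    (nu : R.-pker (borel_rV R n) ~> (borel_rV R n)) (X Y : Omega -> borel_rV R n)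
    (s : R) : measurable_fun setT X -> measurable_fun setT Y ->
  conditional_law P X Y nu ->
  (forall z, (\int[nu z]_v sq_error (z, v) <= s%:E)%E) ->
  (\int[P]_w sq_error (X w, Y w) <= s%:E)%E.
Proof.
move=> mX mY XY nu_le; rewrite (conditional_law_integral mX mY XY) //;
  [|exact: sq_error_ge0|exact: measurable_sq_error].
rewrite -[leRHS]mule1 -(probability_setT P) -integral_cst//.
apply: ge0_le_integral => //.
- by move=> w _; apply: integral_ge0 => v _; exact: sq_error_ge0.
- apply: (measurableT_comp (f := fun z => \int[nu z]_v sq_error (z, v))%E) => //.
  apply: measurable_fun_integral_finite_kernel; first exact: sq_error_ge0.
  exact: measurable_sq_error.
Qed.

End oracle_error.

Theorem theorem3p4 (R : realType) (n : nat)
  (phi f : 'rV[R]_n -> R) (L sigma gamma : R) (K : nat)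
  (oracle : R.-pker (borel_rV R n) ~> (borel_rV R n))
  (d : measure_display) (Omega : measurableType d) (P : probability Omega R)
  (x0 : 'rV[R]_n) (x : nat -> Omega -> 'rV[R]_n)
  (g : nat -> {RV P >-> borel_rV R n})
  (phi_ref : reference_function phi)
  (phi_lip : forall y ybar : 'rV[R]_n,
     phi (grad_conj phi y - grad_conj phi ybar) <= 2^-1 * enorm (y - ybar) ^+ 2)
  (f_C1 : C1 f) (L_gt0 : 0 < L) (f_smooth : anisotropically_smooth phi f L)
  (f_lb : has_lbound (range f))
  (K_gt0 : (0 < K)%N)
  (oracle_var : forall z : 'rV[R]_n,
     (\int[oracle z]_v ((enorm (grad f z - v) ^+ 2)%:E)
        <= (sigma ^+ 2 / K%:R)%:E)%E)
  (gamma_gt0 : 0 < gamma) (gamma_le : gamma <= L^-1)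
  (x_init : forall w, x 0%N w = x0)
  (x_step : forall k w, (k < K)%N ->
     x k.+1 w = x k w - gamma *: grad_conj phi (g k w))
  (g_law : forall k, (k < K)%N ->
     conditional_law (T1 := borel_rV R n) P (x k) (g k) oracle) :
  ('E_P[(fun w => K%:R^-1 * \sum_(k < K) phi (grad_conj phi (grad f (x k w))))%R]
   <= (K%:R^-1 * ((f x0 - inf (range f)) / gamma + sigma ^+ 2 / 2))%:E)%E.
Proof.
have cgrad : continuous (grad f) by have [] := f_C1.
have cgc : continuous (grad_conj phi) := grad_conj_continuous phi_ref phi_lip.
pose a k w := phi (grad_conj phi (grad f (x k w))).
pose h k w := enorm (grad f (x k w) - g k w) ^+ 2.
have f_inf y : inf (range f) <= f y by apply: ge_inf => //; exists y.
have mg k : measurable_fun setT (g k : Omega -> borel_rV R n) by [].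
(* Induction stops at [K], since the recursion [x_step] is given only for [k < K]. *)
have mx k : (k <= K)%N -> measurable_fun setT (x k : Omega -> borel_rV R n).
  elim: k => [_|k IH kK].
    by rewrite (_ : x 0%N = cst x0); [exact: measurable_cst|exact/funext].
  apply: measurable_fun_rV => i.
  rewrite (_ : (fun w => _) = fun w =>
    x k w 0 i - gamma * grad_conj phi (g k w) 0 i); last first.
    by apply/funext => w; rewrite x_step// !mxE.
  apply: measurable_funB.
    exact: (measurableT_comp (measurable_coord i) (IH (ltnW kK))).
  apply: measurable_funM => //; apply: (measurableT_comp (measurable_coord i)).
  exact: (measurableT_comp (continuous_borel_measurable cgc) (mg k)).
have ma k : (k < K)%N -> measurable_fun setT (a k).
  move=> /ltnW/mx mxk; apply: (measurableT_comp
    (continuous_borel_measurable_real (reference_continuous phi_ref))).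
  apply: (measurableT_comp (continuous_borel_measurable cgc)).
  exact: (measurableT_comp (continuous_borel_measurable cgrad)).
have mh k : (k < K)%N -> measurable_fun setT (h k).
  move=> /ltnW/mx mxk; apply/measurable_EFinP.
  exact: (measurableT_comp (measurable_sq_error cgrad)
    (measurable_fun_pair mxk (mg k))).
have h_le k : (k < K)%N -> (\int[P]_w (h k w)%:E <= (sigma ^+ 2 / K%:R)%:E)%E.
  move=> kK; exact: (oracle_sq_error_le cgrad (mx _ (ltnW kK)) (mg k)
    (g_law _ kK) oracle_var).
(* Telescoped descent along one path; [f (x k w)] is kept for the induction and bounded below by the
   infimum only at [k = K]. *)
have descent w k : (k <= K)%N -> gamma * \sum_(j < k) a j w <=
    f x0 - f (x k w) + gamma / 2 * \sum_(j < k) h j w.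
  elim: k => [_|k IH kK]; first by rewrite !big_ord0 x_init subrr !mulr0 addr0.
  rewrite !big_ord_recr/=; have := IH (ltnW kK).
  have := descent_step phi_ref phi_lip (x k w) (g k w) L_gt0 f_smooth
    gamma_gt0 gamma_le.
  rewrite -x_step// -/(a k w) -/(h k w) !mulrDr; lra.
(* Dividing the telescoped bound by [gamma * K] leaves [c] plus [b] times the sum of squared
   errors. *)
pose c := K%:R^-1 * ((f x0 - inf (range f)) / gamma).
pose b : R := K%:R^-1 / 2.
have K0 : 0 < K%:R :> R by rewrite ltr0n.
have c0 : 0 <= c.
  by rewrite mulr_ge0 ?invr_ge0 ?(ltW K0)// divr_ge0 ?(ltW gamma_gt0)// subr_ge0.
have b0 : 0 <= b by rewrite divr_ge0// invr_ge0 ltW.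
have h0 k w : 0 <= h k w by exact: sqr_ge0.
have mhE (k : 'I_K) : measurable_fun setT (EFin \o h k) by exact/measurable_EFinP/mh.
(* All integrands are nonnegative and measurable, so monotonicity and linearity hold in the extended
   reals. *)
rewrite unlock; apply: (@le_trans _ _
  (\int[P]_w (c%:E + b%:E * \sum_(k < K) (h k w)%:E))%E).
  apply: ge0_le_integral => //.
  - move=> w _; rewrite lee_fin mulr_ge0 ?invr_ge0 ?(ltW K0)// sumr_ge0// => k _.
    exact: reference_ge0.
  - apply/measurable_EFinP; apply: measurable_funM => //.
    by apply: measurable_sum => k; exact: ma.
  - apply: emeasurable_funD => //; apply: measurable_funeM.
    by apply: emeasurable_sum => k; exact: mhE.
  - move=> w _; rewrite sumEFin -EFinM -EFinD lee_fin /c /b -mulrA -mulrDr.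
    rewrite ler_pM2l ?invr_gt0// -(ler_pM2l gamma_gt0).
    apply: (le_trans (descent w K (leqnn K))).
    rewrite mulrDr [gamma * (_ / gamma)]mulrC divfK ?gt_eqF// mulrA.
    by rewrite lerD2r lerB.
rewrite ge0_integralD//; last 2 first.
- by move=> w _; rewrite mule_ge0// sume_ge0// => k _; rewrite lee_fin.
- by apply: measurable_funeM; apply: emeasurable_sum => k; exact: mhE.
have -> : (\int[P]__ c%:E = c%:E)%E.
  by rewrite integral_cst// -[RHS]mule1; congr (_ * _)%E; exact: probability_setT.
rewrite ge0_integralZl//; last 2 first.
- by apply: emeasurable_sum => k; exact: mhE.
- by move=> w _; rewrite sume_ge0// => k _; rewrite lee_fin.
rewrite ge0_integral_sum//; last by move=> k w _; rewrite lee_fin.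
rewrite mulrDr EFinD leeD2l//.
(* The [K] errors of mean at most [sigma ^+ 2 / K] add up to [sigma ^+ 2], so the factor [K] in the
   oracle variance cancels. *)
apply: (@le_trans _ _ (b%:E * \sum_(k < K) (sigma ^+ 2 / K%:R)%:E)%E).
  by rewrite lee_wpmul2l ?lee_fin//; apply: lee_sum => k _; exact: h_le.
rewrite sumEFin sumr_const card_ord -EFinM lee_fin -[X in b * X]mulr_natr.
rewrite divfK ?gt_eqF//.
by rewrite /b -mulrA [2^-1 * _]mulrC.
Qed.
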